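(* Let $(X,\mathcal{I})$ be a Polish ideal space such that every set in $\mathcal{B}_+(X)$ contains an $\mathcal{I}$-positive closed set. Suppose $\mathcal{A}$ is a strongly Borel measurable partition of $X$ into $\mathcal{I}$-null closed sets. Then there is a subfamily $\mathcal{A}_0\subseteq\mathcal{A}$ such that $\bigcup\mathcal{A}_0$ is completely $\mathcal{I}$-nonmeasurable.
   Context: $\mathcal{B}(X)$ is the Borel $\sigma$-algebra of $X$. A pair $(X,\mathcal{I})$ is a Polish ideal space if $X$ is an uncountable Polish space and $\mathcal{I}$ is a proper $\sigma$-ideal of subsets of $X$ that contains all singletons and has a Borel base, i.e. every $A\in\mathcal{I}$ is contained in a Borel set belonging to $\mathcal{I}$. Sets in $\mathcal{I}$ are called $\mathcal{I}$-null; subsets of $X$ not in $\mathcal{I}$ are called $\mathcal{I}$-positive. Put $\mathcal{B}_+(X)=\mathcal{B}(X)\setminus\mathcal{I}$. A set $A\subseteq X$ is completely $\mathcal{I}$-nonmeasurable if for every $B\in\mathcal{B}_+(X)$ both $A\cap B\neq\emptyset$ and $(X\setminus A)\cap B\neq\emptyset$. For a partition $\pi$ of $X$ and $A\subseteq X$, the saturation of $A$ is $A^*=\bigcup\{E\in\pi: E\cap A\neq\emptyset\}$. The partition $\pi$ is strongly Borel measurable if the saturation of every closed subset of $X$ is Borel. *)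

(* Defs.v *)
From mathcomp Require Import all_boot all_order all_algebra.
From mathcomp Require Import all_classical all_reals all_analysis.

Set Implicit Arguments.
Unset Strict Implicit.
Unset Printing Implicit Defensive.

Import Order.TTheory GRing.Theory Num.Theory.

Local Open Scope classical_set_scope.
Local Open Scope ring_scope.

(* A Polish space carries a topology but no distinguished metric, so metrics are
   predicates on functions here rather than a metricType structure on X. *)
Record is_metric (R : realType) (X : Type) (d : X -> X -> R) : Prop := IsMetric {
  metric_refl : forall x, d x x = 0 ;
  metric_pos : forall x y, d x y = 0 -> x = y ;
  metric_symm : forall x y, d x y = d y x ;
  metric_tri : forall x y z, d x z <= d x y + d y z
}.

Definition metric_ball (R : realType) (X : Type) (d : X -> X -> R)
  (x : X) (e : R) : set X := [set y | d x y < e].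

Definition metrizes (R : realType) (X : topologicalType) (d : X -> X -> R) :=
  forall x : X, nbhs x = nbhs_ball_ (metric_ball d) x.

Definition complete_metric (R : realType) (X : topologicalType)
    (d : X -> X -> R) :=
  forall u : nat -> X,
    (forall e : R, 0 < e ->
       exists N : nat, forall m n, (N <= m)%N -> (N <= n)%N ->
         d (u m) (u n) < e) ->
    exists x : X, u @ \oo --> x.

Definition completely_metrizable (R : realType) (X : topologicalType) :=
  exists d : X -> X -> R, [/\ is_metric d, metrizes d & complete_metric d].

Definition separable (X : topologicalType) :=
  exists2 D : set X, countable D & dense D.

Definition polish_space (R : realType) (X : topologicalType) :=
  separable X /\ completely_metrizable R X.

Definition borel (X : topologicalType) : set (set X) := <<s @open X >>.

Record sigma_ideal (X : Type) (I : set (set X)) : Prop := SigmaIdeal {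
  sigma_ideal0 : I set0 ;
  sigma_idealS : forall A B : set X, A `<=` B -> I B -> I A ;
  sigma_ideal_bigcup : forall F : nat -> set X,
    (forall n, I (F n)) -> I (\bigcup_n F n)
}.

(* R only serves as the codomain of the metrics on X; all instances of realType
   are isomorphic, so its choice is immaterial. *)
Record polish_ideal_space (R : realType) (X : topologicalType)
    (I : set (set X)) : Prop := PolishIdealSpace {
  pis_polish : polish_space R X ;
  pis_uncountable : ~ countable [set: X] ;
  pis_sigma_ideal : sigma_ideal I ;
  pis_proper : ~ I [set: X] ;
  pis_singleton : forall x : X, I [set x] ;
  pis_borel_base : forall A : set X, I A ->
    exists B : set X, [/\ borel B, I B & A `<=` B]
}.

Definition borel_positive (X : topologicalType) (I : set (set X)) :
  set (set X) := @borel X `\` I.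

Definition completely_nonmeasurable (X : topologicalType) (I : set (set X))
    (A : set X) :=
  forall B : set X, borel_positive I B ->
    A `&` B !=set0 /\ ~` A `&` B !=set0.

Definition saturation (X : Type) (P : set (set X)) (A : set X) : set X :=
  \bigcup_(E in [set E | P E /\ E `&` A !=set0]) E.

Definition strongly_borel_measurable (X : topologicalType)
    (P : set (set X)) :=
  forall F : set X, closed F -> borel (saturation P F).

(* Main.v *)
Require Import Defs.
From Stdlib Require Import Inverse_Image.
From mathcomp Require Import all_boot all_order all_algebra.
From mathcomp Require Import all_classical all_reals all_analysis.

Set Implicit Arguments.
Unset Strict Implicit.
Unset Printing Implicit Defensive.

Import Order.TTheory GRing.Theory Num.Theory.

Local Open Scope classical_set_scope.

(* The closed classes are separated by their traces on countably many closed
   balls K_w, so x |-> (x in K_w^* )_w is a Borel code of the class of x. A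
   positive closed set F meets uncountably many classes, since the classes are null.
   Writing the Borel sets K_w^* and their complements as projections of closed
   subsets of the product of X with the Baire space, the code becomes continuous
   on a closed set lying over F, and a Cantor scheme there yields 2^nat points
   of F with distinct codes. As there are at most 2^nat closed sets, a Bernstein
   construction on the codes gives a family of classes that meets every positive
   closed set and whose complementary family does too. *)

(** * Well-orders and the Bernstein construction *)

Lemma wf_total_order (T : eqType) : exists lt : T -> T -> Prop,
  well_founded lt /\ forall s t, [\/ s = t, lt s t | lt t s].
Proof.
have [R woR] := wochoice.well_ordering_principle T.
have exmin (A : set T) t : A t -> exists m, [/\ A m, forall s, A s -> R m s
    & forall m', A m' -> (forall s, A s -> R m' s) -> m = m'].
  move=> At; case: (woR [pred s | `[< A s >]]) => [|m [[Am minm] uniqm]].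
    by exists t; apply/asboolP.
  exists m; split=> [|s As|m' Am' minm']; first exact/asboolP.
    by apply: minm; apply/asboolP.
  by apply: uniqm; split=> [|s /asboolP /minm' //]; apply/asboolP.
(* [R] is a non-strict well-order; its strict part is the negation of the reversed relation. *)
exists (fun s t => ~~ R t s); split.
  move=> t; apply: contrapT => /(exmin [set s | ~ Acc _ s])[m [nAm minm _]].
  apply: nAm; constructor => s ltsm; apply: contrapT => /minm Rms.
  by rewrite Rms in ltsm.
(* Antisymmetry comes from the uniqueness of the minimum of the pair [[set s; t]]. *)
have antiR s t : R s t -> R t s -> s = t.
  move=> Rst Rts; have refl u : R u u.
    by have [v [-> + _]] := exmin [set u] u erefl; apply.
  have [m [_ _ uniqm]] := exmin [set s; t] s (or_introl erefl).
  rewrite -(uniqm s) ?(uniqm t)//=; [by right| |by left|];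
  by move=> u [] ->.
move=> s t; case Rst: (R s t); last by apply: Or33.
case Rts: (R t s); last by apply: Or32.
by apply: Or31; exact: antiR.
Qed.

(* Cutting a well-order at the least initial segment into which T injects gives
   an order in which every initial segment is smaller than T. *)
Lemma wf_initial_order (T : eqType) : exists lt : T -> T -> Prop,
  [/\ well_founded lt, forall s t, [\/ s = t, lt s t | lt t s]
    & forall t, ~ exists2 f : T -> T, injective f & forall s, lt (f s) t].
Proof.
have [lt [wf tri]] := wf_total_order T.
pose inj_below t := exists2 f : T -> T, injective f & forall s, lt (f s) t.
have [[t it]|none] := pselect (exists t, inj_below t); last first.
  by exists lt; split => // t it; apply: none; exists t.
elim/(well_founded_ind wf): t it => t IH [k kinj klt].
have [[s sltt /(IH _ sltt)//]|minimal] :=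
  pselect (exists2 s, lt s t & inj_below s).
exists (fun s s' => lt (k s) (k s')); split.
- exact: wf_inverse_image.
- move=> s s'; have [/kinj| |] := tri (k s) (k s').
  + exact: Or31.
  + exact: Or32.
  + exact: Or33.
- move=> s [f finj flt]; apply: minimal; exists (k s) => //.
  by exists (k \o f) => // x y /kinj /finj.
Qed.

(* Transfinite recursion of length |T|: at stage (j, b) pick a point of [G j]
   different from all earlier ones; the points picked at stages (j, true) form
   the required set. *)
Lemma bernstein (T : eqType) (J Y : Type) (i : J * bool -> T) (G : J -> set Y) :
    injective i ->
    (forall j, exists2 h : T -> Y, injective h & forall t, G j (h t)) ->
  exists S : set Y, forall j, S `&` G j !=set0 /\ ~` S `&` G j !=set0.
Proof.
move=> iinj Ginj; have [lt [wf tri nolt]] := wf_initial_order T.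
pose ltK k k' := lt (i k) (i k').
have wfK : well_founded ltK by exact: wf_inverse_image.
(* The guard on [kV.2] makes the relation total, so the choice function exists before the recursion.
   If all values of [h] were used up at earlier stages, choosing such stages would inject [T] below
   [i k]. *)
have fresh (kV : (J * bool) * set Y) : exists y,
    (exists2 p : J * bool -> Y, True &
      kV.2 = [set p k' | k' in [set k' | ltK k' kV.1]]) ->
    G kV.1.1 y /\ ~ kV.2 y.
  case: kV => k V /=; have [h hinj hG] := Ginj k.1.
  apply: contrapT => /forallNP nofresh.
  have [p _ Vp] : exists2 p : J * bool -> Y, True &
      V = [set p k' | k' in [set k' | ltK k' k]].
    by have /not_implyP[] := nofresh (h (i k)).
  have Vh t : V (h t).
    by have /not_implyP[_ /not_andP[//|/contrapT]] := nofresh (h t).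
  have /choice[f fP] t : exists k', ltK k' k /\ p k' = h t.
    by have := Vh t; rewrite Vp => -[k' /= ? ?]; exists k'.
  apply: (nolt (i k)); exists (i \o f) => [s t /iinj fst|t].
    by apply: hinj; rewrite -(fP s).2 -(fP t).2 fst.
  exact: (fP t).1.
have {fresh}[pick pickP] := choice fresh.
pose step k (rec : forall k', ltK k' k -> Y) :=
  pick (k, [set y | exists k' (l : ltK k' k), rec k' l = y]).
pose p := Fix wfK (fun=> Y) step.
have pE k : p k = pick (k, [set p k' | k' in [set k' | ltK k' k]]).
  (* [step] sees the recursive calls only through their set of values, hence is extensional. *)
  rewrite /p Fix_eq; last first.
    move=> k0 f g fg; rewrite /step; congr (pick (_, _)); apply/seteqP.
    by split=> y /= [k' [l <-]]; exists k', l; rewrite fg.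
  rewrite {1}/step; congr (pick (_, _)); apply/seteqP.
  by split=> y /= [k']; [move=> [l <-]; exists k' | move=> l <-; exists k', l].
have pP k : G k.1 (p k) /\ ~ (exists2 k', ltK k' k & p k' = p k).
  rewrite [p k]pE.
  by apply: (pickP (k, [set p k' | k' in [set k' | ltK k' k]])); exists p.
have pinj k k' : p k = p k' -> k = k'.
  move=> pkk'; have [/iinj//|l|l] := tri (i k) (i k').
    by have [] := pP k'; move=> _ []; exists k.
  by have [] := pP k; move=> _ []; exists k'.
exists [set p (j, true) | j in setT] => j; split.
  by exists (p (j, true)); split; [exists j | exact: (pP (j, true)).1].
exists (p (j, false)); split; last exact: (pP (j, false)).1.
by move=> [j' _ /pinj].
Qed.

(** * Neighbourhoods, limits and closed balls in terms of the metric *)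

Section Metric.
Context (R : realType) (X : topologicalType) (d : X -> X -> R).
Hypotheses (dM : is_metric d) (dX : metrizes d).
Local Open Scope ring_scope.

Lemma nbhs_metric x (A : set X) :
  nbhs x A <-> exists2 e : R, 0 < e & forall y, d x y < e -> A y.
Proof. by rewrite dX; split=> -[e e0 eA]; exists e. Qed.

Lemma metric_cvg (u : nat -> X) x : u @ \oo --> x <->
  forall e : R, 0 < e -> \forall n \near \oo, d x (u n) < e.
Proof.
split=> [ux e e0|ux A /nbhs_metric[e e0 eA]].
  by apply: (ux [set y | d x y < e]); apply/nbhs_metric; exists e.
by apply: filterS (ux e e0) => n /eA.
Qed.

Lemma closed_metric_ball x e : closed [set y | d x y <= e].
Proof.
rewrite -openC openE => y /= /negP; rewrite -ltNge => exy.
apply/nbhs_metric; exists (d x y - e); first by rewrite subr_gt0.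
move=> z yz; apply/negP; rewrite -ltNge.
move: yz; rewrite (metric_symm dM) ltrBrDr addrC -ltrBrDr => /lt_le_trans.
by apply; rewrite lerBlDr metric_tri.
Qed.

End Metric.

(** * Borel sets as projections of closed sets *)

Section Souslin.
Context (X : topologicalType).

(* sequential closedness in the product of [X] with the Baire space *)
Definition seq_closed (C : X -> (nat -> nat) -> Prop) :=
  forall (u : nat -> X) (a : nat -> nat -> nat) x alpha,
    u @ \oo --> x -> (forall i, \forall k \near \oo, a k i = alpha i) ->
    (\forall k \near \oo, C (u k) (a k)) -> C x alpha.

Definition souslin (A : set X) := exists2 C, seq_closed C &
  forall x, A x <-> exists alpha, C x alpha.

(** The first coordinate selects the index and the shifted sequence is the witness. Along a
    convergent sequence the index is eventually constant, so a single [C n] matters. *)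
Lemma seq_closed_union (C : nat -> X -> (nat -> nat) -> Prop) :
  (forall n, seq_closed (C n)) ->
  seq_closed (fun x alpha => C (alpha 0) x (alpha \o S)).
Proof.
move=> hC u a x alpha ux aalpha Cua.
apply: (hC _ u (fun k => a k \o S)) => //; first by move=> i; exact: aalpha.
by apply: filterS2 (aalpha 0) Cua => k <-.
Qed.

(** Pairing of indices lets one point of the Baire space carry a witness for every [j] at once. *)
Lemma seq_closed_inter (J : countType) (C : J -> X -> (nat -> nat) -> Prop) :
  (forall j, seq_closed (C j)) ->
  seq_closed (fun x alpha => forall j, C j x (fun i => alpha (pickle (j, i)))).
Proof.
move=> hC u a x alpha ux aalpha Cua j.
apply: (hC _ u (fun k i => a k (pickle (j, i)))) => //.
by apply: filterS Cua => k; apply.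
Qed.

Lemma uncurry_pickle (J : countType) (f : J -> nat -> nat) :
  exists alpha : nat -> nat, forall j, (fun i => alpha (pickle (j, i))) = f j.
Proof.
exists (fun n => if @unpickle (J * nat)%type n is Some (j, i)
                 then f j i else 0).
by move=> j; apply/funext => i; rewrite pickleK.
Qed.

Lemma souslin_bigcup (A : nat -> set X) :
  (forall n, souslin (A n)) -> souslin (\bigcup_n A n).
Proof.
move=> sA; have /choice[C CP] n : exists C, seq_closed C /\
    forall x, A n x <-> exists alpha, C x alpha.
  by have [C ? ?] := sA n; exists C.
exists (fun x alpha => C (alpha 0) x (alpha \o S)).
  by apply: seq_closed_union => n; exact: (CP n).1.
move=> x; split=> [[n _ /(CP n).2[alpha Ca]]|[alpha Ca]].
  by exists (fun i => if i is i.+1 then alpha i else n).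
by exists (alpha 0) => //; apply/(CP _).2; exists (alpha \o S).
Qed.

Lemma souslin_bigcap (A : nat -> set X) :
  (forall n, souslin (A n)) -> souslin (\bigcap_n A n).
Proof.
move=> sA; have /choice[C CP] n : exists C, seq_closed C /\
    forall x, A n x <-> exists alpha, C x alpha.
  by have [C ? ?] := sA n; exists C.
exists (fun x alpha => forall n : nat, C n x (fun i => alpha (pickle (n, i)))).
  by apply: seq_closed_inter => n; exact: (CP n).1.
move=> x; split=> [Ax|[alpha Ca] n _]; last first.
  by apply/(CP n).2; exists (fun i => alpha (pickle (n, i))).
have /choice[f fP] n : exists alpha, C n x alpha by apply/(CP n).2/Ax.
have [alpha alphaE] := uncurry_pickle f.
by exists alpha => n; rewrite alphaE.
Qed.

Lemma souslin_closed (F : set X) : closed F -> souslin F.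
Proof.
move=> cF; exists (fun x _ => F x) => [u a x _ ux _ Fu|x].
  exact: (closed_cvg F cF Fu).
by split=> [|[]//]; exists id.
Qed.

Context (R : realType) (d : X -> X -> R).
Hypotheses (dM : is_metric d) (dX : metrizes d).
Local Open Scope ring_scope.

(* the point alpha of the Baire space provides a ball inside the open set *)
Lemma souslin_open (U : set X) : open U -> souslin U.
Proof.
move=> oU.
exists (fun x alpha => forall y, d x y < (alpha 0).+1%:R^-1 -> U y).
  move=> u a x alpha ux aalpha Uu y xy.
  near \oo => k; have aE : a k 0 = alpha 0 by near: k; exact: aalpha.
  have := near Uu k; rewrite aE; apply => //.
  apply: le_lt_trans (metric_tri dM _ x _) _.
  rewrite (metric_symm dM) -ltrBrDr; near: k.
  by apply: (metric_cvg dX u x).1; rewrite // subr_gt0.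
move=> x; split=> [Ux|[alpha]]; last first.
  by apply; rewrite (metric_refl dM) invr_gt0.
have /(nbhs_metric dX)[e e0 eU] : nbhs x U by exact: open_nbhs_nbhs.
have [n ne] := ltr_add_invr e0.
exists (fun=> n) => y xy; apply: eU; apply: lt_trans xy _.
by rewrite add0r in ne.
Unshelve. all: by end_near. Qed.

(** Souslin sets need not be closed under complement, so the induction runs over the sets that are
    Souslin together with their complement; these form a sigma-algebra. *)
Lemma borel_souslin (B : set X) : borel B -> souslin B /\ souslin (~` B).
Proof.
have : @borel X `<=` [set B | souslin B /\ souslin (~` B)].
  apply: smallest_sub => [|U oU]; last first.
    by split; [exact: souslin_open|apply: souslin_closed; rewrite closedC].
  split.
  - split; first exact/souslin_closed/closed0.
    by rewrite setC0; exact/souslin_closed/closedT.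
  - by move=> A [sA sAc]; rewrite setTD; split => //; rewrite setCK.
  - move=> A sA; split; first by apply: souslin_bigcup => n; exact: (sA n).1.
    by rewrite setC_bigcup; apply: souslin_bigcap => n; exact: (sA n).2.
by apply.
Qed.

End Souslin.

(** * Enumerations and Cantor schemes *)

Lemma countable_enum (T : Type) (A : set T) (t0 : T) : countable A ->
  exists e : nat -> T, A `<=` range e.
Proof.
move=> /countable_injP[f finj].
have /choice[e eP] n : exists y, forall x, A x -> f x = n -> x = y.
  have [[y [Ay fy]]|none] := pselect (exists y, A y /\ f y = n).
    by exists y => x Ax fx; apply: finj; rewrite ?inE// fx fy.
  by exists t0 => x Ax fx; case: none; exists x.
by exists e => x Ax; exists (f x) => //; rewrite -(eP (f x) x).
Qed.

Section CantorScheme.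
Context (P : Type) (J : countType) (phi : P -> J -> bool).
Local Notation big Z := (~ countable (phi @` Z)).

Lemma uncountable_piece (I : countType) (G : I -> set P) (Z : set P) :
  (forall p, exists i, G i p) -> big Z -> exists i, big (Z `&` G i).
Proof.
move=> Gcov; apply: contra_notP => /forallNP small.
have : countable (\bigcup_i (phi @` (Z `&` G i))).
  by apply: bigcup_countable => // i _; apply: contrapT; exact: small.
apply: sub_countable; apply: subset_card_le => _ [p Zp <-].
by have [i Gip] := Gcov p; exists i => //; exists p.
Qed.

(** Otherwise each [j] has a value [c j] taken by only countably many codes. Every code agrees with
    [c] somewhere, or is the pointwise negation of [c]: countably many in all. *)
Lemma uncountable_split (Z : set P) : big Z ->
  exists j, forall b, big (Z `&` [set p | phi p j = b]).
Proof.
apply: contra_notP => /forallNP small.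
have /choice[c cP] j : exists b,
    countable (phi @` (Z `&` [set p | phi p j = b])).
  by have /existsNP[b /contrapT] := small j; exists b.
have : countable (\bigcup_o if o is Some j then
    phi @` (Z `&` [set p | phi p j = c j]) else [set (fun j => ~~ c j)]).
  by apply: bigcup_countable => // -[j|].
apply: sub_countable; apply: subset_card_le => _ [p Zp <-].
have [|/forallNP noj] := pselect (exists j, phi p j = c j).
  by move=> [j pj]; exists (Some j) => //; exists p.
exists None => //; apply/funext => j; apply/eqP; move: (noj j) => /eqP.
by case: (phi p j) (c j) => -[].
Qed.

Lemma cantor_scheme (I : countType) (G : nat -> I -> set P) (Z : set P) :
    (forall n p, exists i, G n i p) -> big Z ->
  exists T : (nat -> bool) -> nat -> set P, [/\
    forall b, T b 0 = Z,
    forall b n, T b n.+1 `<=` T b n /\ exists i, T b n.+1 `<=` G n i,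
    forall b n, T b n !=set0 &
    forall b c n, (forall k, (k < n)%N -> b k = c k) ->
      exists j, (forall p, T b n.+1 p -> phi p j = b n) /\
                (forall p, T c n.+1 p -> phi p j = c n)].
Proof.
move=> Gcov bigZ.
(* One step splits [W.1] at a coordinate [j] and shrinks both halves into pieces of the cover of
   level [W.2]. The constant [set0] is a default for small [W.1]. *)
have /choice[step stepP] (W : set P * nat) : exists f : bool -> set P,
    big W.1 -> exists j, forall b, [/\ f b `<=` W.1, big (f b),
      exists i, f b `<=` G W.2 i & forall p, f b p -> phi p j = b].
  have [bigW|] := pselect (big W.1); last by exists (fun=> set0).
  have [j jP] := uncountable_split bigW.
  have /choice[f fP] b := uncountable_piece (Gcov W.2) (jP b).
  exists (fun b => W.1 `&` [set p | phi p j = b] `&` G W.2 (f b)) => _.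
  exists j => b; split => //.
  - by move=> p [[]].
  - by exists (f b) => p [].
  - by move=> p [[]].
pose T (b : nat -> bool) := fix T n : set P :=
  if n is n'.+1 then step (T n', n') (b n') else Z.
have bigT b n : big (T b n).
  elim: n => [//|n IH] /=; have [j /(_ (b n))[_ + _ _]] := stepP (T b n, n) IH.
  exact.
exists T; split => //.
- move=> b n; have [j /(_ (b n))[? _ ? _]] := stepP (T b n, n) (bigT b n).
  by split.
- move=> b n; apply/set0P; apply: contra_notN (bigT b n) => /eqP ->.
  by rewrite image_set0.
- move=> b c n bc.
  (* [T b n] depends only on the first [n] bits, so both branches split at the same [j]. *)
  have Tbc m : (m <= n)%N -> T b m = T c m.
    by elim: m => [//|m IH mn] /=; rewrite IH ?bc// ltnW.
  have [j jP] := stepP (T b n, n) (bigT b n).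
  exists j; split=> p /=; first by have [_ _ _] := jP (b n); apply.
  by rewrite -Tbc//; have [_ _ _] := jP (c n); apply.
Qed.

End CantorScheme.

Lemma decreasing_subset (T : Type) (A : nat -> set T) :
  (forall n, A n.+1 `<=` A n) -> forall n m, (n <= m)%N -> A m `<=` A n.
Proof.
move=> Adec n m /subnK <-; elim: (m - n)%N => [//|k IH].
exact: subset_trans (Adec _) IH.
Qed.

(** * Continuum many codes on a closed set *)

Section Perfect.
Context (R : realType) (X : topologicalType) (d : X -> X -> R).
Hypotheses (dM : is_metric d) (dX : metrizes d) (dC : complete_metric d).
Context (e : nat -> X).
Hypothesis edense : forall x (r : R), (0 < r)%R -> exists n, (d (e n) x < r)%R.

(** A small ball times a cylinder of the Baire space: nested cells force the first components to be
    Cauchy and the second ones to stabilise. *)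
Definition cell n (w : nat * seq nat) : set (X * (nat -> nat)) :=
  [set p | (d (e w.1) p.1 < n.+1%:R^-1)%R /\ mkseq p.2 n = w.2].

Lemma cell_cover n p : exists w, cell n w p.
Proof.
have [i ip] : exists i, (d (e i) p.1 < n.+1%:R^-1)%R.
  by apply: edense; rewrite invr_gt0.
by exists (i, mkseq p.2 n).
Qed.

(** Points chosen in the [T n] converge, and closedness of [C] keeps the limit in [C], although it
    may leave the sets [T n]. *)
Lemma cell_limit (C : X -> (nat -> nat) -> Prop)
    (T : nat -> set (X * (nat -> nat))) :
    seq_closed C -> (forall p, T 0 p -> C p.1 p.2) ->
    (forall n, T n.+1 `<=` T n /\ exists w, T n.+1 `<=` cell n w) ->
    (forall n, T n !=set0) ->
  exists x alpha, C x alpha /\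
    forall i, exists n, forall p, T n p -> p.2 i = alpha i.
Proof.
move=> Ccl TC Tcell /choice[p pT].
have Tmono := decreasing_subset (fun n => (Tcell n).1).
pose u k := (p k).1.
have [x ux] : exists x : X, u @ \oo --> x.
  apply: dC => r r0; have [|N Nr] := @ltr_add_invr R 0 (r / 2).
    by rewrite divr_gt0.
  have [w Tw] := (Tcell N).2; exists N.+1 => m n Nm Nn.
  have [mw _] := Tw _ (Tmono _ _ Nm _ (pT m)).
  have [nw _] := Tw _ (Tmono _ _ Nn _ (pT n)).
  apply: le_lt_trans (metric_tri dM _ (e w.1) _) _.
  rewrite (metric_symm dM) [r]splitr; apply: ltrD.
    by apply: lt_trans mw _; rewrite add0r in Nr.
  by apply: lt_trans nw _; rewrite add0r in Nr.
(* [T n.+1] lies in a cell of level [n], which fixes the coordinates below [n]; hence the index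
   [i.+2]. *)
have coord i q : T i.+2 q -> q.2 i = (p i.+2).2 i.
  have [w Tw] := (Tcell i.+1).2 => /Tw[_ qw]; have [_ pw] := Tw _ (pT i.+2).
  by rewrite -(nth_mkseq 0 q.2 (ltnSn i)) qw -pw nth_mkseq.
exists x, (fun i => (p i.+2).2 i); split; last first.
  by move=> i; exists i.+2; exact: coord.
apply: (Ccl _ (fun k => (p k).2) _ _ ux).
  move=> i; exists i.+2 => // k /= ik; apply: coord.
  exact: Tmono ik _ (pT k).
by apply: nearW => k; apply: TC; exact: Tmono (leq0n k) _ (pT k).
Qed.

Lemma perfect_image (J : countType) (B : J -> set X) (F : set X) :
    (forall j, souslin (B j) /\ souslin (~` B j)) -> closed F ->
    ~ countable [set (fun j => `[< B j x >]) | x in F] ->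
  exists2 h : (nat -> bool) -> X, (forall b, F (h b)) &
    injective (fun b j => `[< B j (h b) >]).
Proof.
move=> sB Fcl Func.
have /choice[C CP] (jb : J * bool) : exists C, seq_closed C /\
    forall x, `[< B jb.1 x >] = jb.2 <-> exists alpha, C x alpha.
  case: jb => j b; have [[C ? CB] [C' ? CB']] := sB j; case: b.
    by exists C; split=> // x; rewrite -CB; split=> /asboolP.
  exists C'; split=> // x; rewrite -CB'.
  by split; [move/negbT/asboolPn|move/asboolPn/negbTE].
(* The block of [alpha] at [j] starts with a flag, zero exactly when [x] is in [B j], followed by a
   witness for that side. *)
pose D x alpha := F x /\ forall j,
  C (j, alpha (pickle (j, 0)) == 0) x (fun i => alpha (pickle (j, i.+1))).
have Dcl : seq_closed D.
  move=> u a x alpha ux aalpha uaD; split.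
    have Fu : \forall k \near \oo, F (u k) by apply: filterS uaD => k [].
    exact: (closed_cvg F Fcl Fu).
  apply: (@seq_closed_inter _ J (fun j x gamma =>
    C (j, gamma 0 == 0) x (gamma \o S)) _ u a) => //; last first.
    exact: (filterS (fun k (Dk : D (u k) (a k)) => Dk.2) uaD).
  by move=> j; exact: (seq_closed_union (fun n => (CP (j, n == 0)).1)).
have DB x alpha j : D x alpha -> `[< B j x >] = (alpha (pickle (j, 0)) == 0).
  move=> [_ /(_ j) Cj]; apply/(CP (j, alpha (pickle (j, 0)) == 0)).2.
  by exists (fun i => alpha (pickle (j, i.+1))).
have FD x : F x -> exists alpha, D x alpha.
  move=> Fx; have /choice[f fP] j : exists gamma, C (j, `[< B j x >]) x gamma.
    exact/(CP (j, `[< B j x >])).2.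
  have [alpha alphaE] := uncurry_pickle
    (fun j i => if i is i'.+1 then f j i' else (~~ `[< B j x >] : nat)).
  exists alpha; split=> // j.
  have -> : (fun i => alpha (pickle (j, i.+1))) = f j.
    by apply/funext => i; have /(congr1 (@^~ i.+1)) := alphaE j.
  have /(congr1 (@^~ 0)) /= -> := alphaE j.
  by case: `[< _ >] (fP j).
(* The code is read off the flags alone, so it is continuous in [alpha]. *)
pose phi (p : X * (nat -> nat)) j := p.2 (pickle (j : J, 0)) == 0.
have bigD : ~ countable (phi @` [set p | D p.1 p.2]).
  apply: contra_not Func; apply: sub_countable; apply: subset_card_le.
  move=> _ [x Fx <-].
  have [alpha Da] := FD x Fx; exists (x, alpha) => //; apply/funext => j.
  by rewrite (DB _ _ j Da).
have [T [T0 Tcell Tn0 Tsplit]] := cantor_scheme cell_cover bigD.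
have /choice[h hP] b := @cell_limit D (T b) Dcl
  ltac:(by rewrite T0) (Tcell b) (Tn0 b).
(* The flag at [j] of the limit is shared by all points deep enough in the branch, so the value of
   [phi] on [T b n] passes to [h b]. *)
have hcode b j n v : (forall p, T b n p -> phi p j = v) -> `[< B j (h b) >] = v.
  move=> Tv; have [alpha [Da aT]] := hP b; rewrite (DB _ _ j Da).
  have [m Tm] := aT (pickle (j, 0)).
  have Tmono := decreasing_subset (fun n => (Tcell b n).1).
  have [p Tp] := Tn0 b (maxn m n).
  rewrite -(Tv p (Tmono _ _ (leq_maxr _ _) _ Tp)) /phi.
  by rewrite (Tm p (Tmono _ _ (leq_maxl _ _) _ Tp)).
exists h => [b|b c hbc]; first by have [alpha [[]]] := hP b.
apply: contrapT => /eqP bc.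
have ex : exists n, b n != c n.
  apply: contrapT => /forallNP beq; move/eqP: bc; apply; apply/funext => n.
  by apply/eqP/negPn/negP; exact: beq.
(* At the first bit where [b] and [c] differ, the scheme separates the two codes. *)
case: (ex_minnP ex) => n bcn minn.
have [k kn|j [bj cj]] := Tsplit b c n.
  by apply/eqP/negPn; apply: contraL kn => /minn; rewrite -leqNgt.
move: bcn; rewrite -(hcode b j n.+1 _ bj) -(hcode c j n.+1 _ cj).
by rewrite (congr1 (@^~ j) hbc) eqxx.
Qed.

End Perfect.

(** * Countable null unions, dense sequences and traces on balls *)

Lemma sigma_ideal_bigcup_countable (X T : Type) (I : set (set X)) (D : set T)
    (F : T -> set X) :
  sigma_ideal I -> countable D -> (forall t, D t -> I (F t)) ->
  I (\bigcup_(t in D) F t).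
Proof.
move=> sI cD IF; have [->|/set0P[t0 _]] := eqVneq D set0.
  by rewrite bigcup_set0; exact: sigma_ideal0 sI.
have [e De] := countable_enum t0 cD.
(* Indices enumerating a point outside [D] contribute the empty set. *)
have IG n : I (F (e n) `&` [set _ | D (e n)]).
  have [Den|nDen] := pselect (D (e n)).
    by apply: (sigma_idealS sI _ (IF _ Den)) => x [].
  by apply: (sigma_idealS sI _ (sigma_ideal0 sI)) => x [].
apply: (sigma_idealS sI _ (sigma_ideal_bigcup sI IG)) => x [t Dt Ftx].
by have [n _ nt] := De t Dt; exists n => //; rewrite nt.
Qed.

Lemma separable_dense_seq (R : realType) (X : topologicalType) (d : X -> X -> R)
    (x0 : X) :
  is_metric d -> metrizes d -> separable X ->
  exists e : nat -> X, forall x (r : R), (0 < r)%R ->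
    exists n, (d (e n) x < r)%R.
Proof.
move=> dM dX [D cD denseD]; have [e De] := countable_enum x0 cD.
exists e => x r r0.
have [U [oU Ux] Ur] : exists2 U, open_nbhs x U & U `<=` [set y | (d x y < r)%R].
  suff : nbhs x [set y | (d x y < r)%R] by rewrite nbhsE.
  by apply/(nbhs_metric dX); exists r.
have [y [/Ur + /De[n _ ny]]] := denseD U (ex_intro _ x Ux) oU.
by exists n; rewrite ny metric_symm.
Qed.

Section BallTrace.
Context (R : realType) (X : topologicalType) (d : X -> X -> R).
Hypotheses (dM : is_metric d) (dX : metrizes d).
Context (e : nat -> X).
Hypothesis edense : forall x (r : R), (0 < r)%R -> exists n, (d (e n) x < r)%R.

(** The balls are closed because strong Borel measurability speaks of saturations of closed sets. *)
Definition basic_ball (w : nat * nat) : set X :=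
  [set y | (d (e w.1) y <= w.2.+1%:R^-1)%R].

Definition ball_trace (F : set X) (w : nat * nat) :=
  `[< F `&` basic_ball w !=set0 >].

(** A point of [F] outside [F'] would lie in a basic ball, of radius below half its distance to
    [F'], that misses [F']. *)
Lemma ball_trace_sub (F F' : set X) : closed F' ->
  ball_trace F = ball_trace F' -> F `<=` F'.
Proof.
move=> clF' FF' x Fx; apply: contrapT => nF'x.
have /(nbhs_metric dX)[r r0 rF'] : nbhs x (~` F').
  by apply: open_nbhs_nbhs; split; rewrite ?openC.
have [|m mr] := @ltr_add_invr R 0 (r / 2); first by rewrite divr_gt0.
rewrite add0r in mr.
have [n nx] : exists n, (d (e n) x < m.+1%:R^-1)%R.
  by apply: edense; rewrite invr_gt0.
have : ball_trace F (n, m) by apply/asboolP; exists x; split=> //; exact: ltW.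
rewrite FF' => /asboolP[y [F'y /= ny]]; apply: (rF' y) => //.
apply: le_lt_trans (metric_tri dM _ (e n) _) _.
rewrite [r]splitr (metric_symm dM); apply: ltrD; first exact: lt_trans nx mr.
exact: le_lt_trans ny mr.
Qed.

Lemma ball_trace_inj (F F' : set X) : closed F -> closed F' ->
  ball_trace F = ball_trace F' -> F = F'.
Proof.
by move=> clF clF' FF'; apply/seteqP; split; apply: ball_trace_sub.
Qed.

End BallTrace.

(** * Borel codes of the classes and the conclusion *)

Lemma partition_saturation (X : Type) (A : set (set X)) (E K : set X) (x : X) :
  trivIset A id -> A E -> E x -> saturation A K x <-> E `&` K !=set0.
Proof.
move=> tA AE Ex; split=> [[E' [AE' E'K] E'x]|EK]; last by exists E.
by rewrite (tA E E')//; exists x.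
Qed.

Theorem theorem2p1 (R : realType) (X : topologicalType) (I : set (set X))
    (hXI : polish_ideal_space R I)
    (hclosed : forall B : set X, borel_positive I B ->
       exists F : set X, [/\ closed F, ~ I F & F `<=` B])
    (A : set (set X))
    (hpart : partition A id [set: X])
    (hmeas : strongly_borel_measurable A)
    (hnull : forall E : set X, A E -> closed E /\ I E) :
  exists2 A0 : set (set X),
    A0 `<=` A & completely_nonmeasurable I (\bigcup_(E in A0) E).
Proof.
case: hXI => [[sepX [d [dM dX dC]]] _ sI Iproper _ _].
case: hpart => coverA trivA _.
have [x0 _] : [set: X] !=set0.
  by apply/set0P/eqP => X0; apply: Iproper; rewrite X0; exact: sigma_ideal0 sI.
have [e edense] := separable_dense_seq x0 dM dX sepX.
have class x : exists2 E, A E & E x.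
  by have : cover A id x by rewrite coverA.
pose B w := saturation A (basic_ball d e w).
pose code x w := `[< B w x >].
have codeE E x : A E -> E x -> code x = ball_trace d e E.
  move=> AE Ex; apply/funext => w.
  exact/asbool_equiv_eq/partition_saturation.
have sB w : souslin (B w) /\ souslin (~` B w).
  apply: (borel_souslin dM dX); apply: hmeas.
  exact: closed_metric_ball.
(* Each fibre of [code] is a single class, since closed sets are determined by their traces.
   Countably many codes would thus cover [F] by countably many null classes. *)
have codeF (F : set X) : closed F -> ~ I F -> ~ countable (code @` F).
  move=> clF nIF; apply: contra_not nIF => cF.
  apply: (sigma_idealS sI _ (sigma_ideal_bigcup_countable
    (F := fun c => [set x | code x = c]) sI cF _)) => [x Fx|_ [x _ <-] /=].
    by exists (code x) => //; exists x.
  have [E AE Ex] := class x; apply: (sigma_idealS sI _ (hnull _ AE).2) => y /=.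
  have [E' AE' E'y] := class y; rewrite (codeE _ _ AE Ex) (codeE _ _ AE' E'y).
  by move=> /(ball_trace_inj dM dX edense (hnull _ AE').1 (hnull _ AE).1) <-.
pose J := {F : set X | closed F /\ ~ I F}.
(* Stages inject into [nat -> bool]: the trace determines the closed set, the position of [None]
   stores the bit, and numbers that code nothing get [false]. *)
pose idx (jb : J * bool) (n : nat) :=
  if @unpickle (option (nat * nat)) n is Some o then
    if o is Some w then ball_trace d e (sval jb.1) w else jb.2
  else false.
have idx_inj : injective idx.
  move=> [[F hF] b] [[F' hF'] b'] idxE; congr pair.
    apply: eq_exist; apply: (ball_trace_inj dM dX edense hF.1 hF'.1).
    apply/funext => w; have := congr1 (@^~ (pickle (Some w))) idxE.
    by rewrite /idx pickleK.
  by have := congr1 (@^~ (pickle (None : option (nat * nat)))) idxE;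
    rewrite /idx pickleK.
have [|S hS] := bernstein (G := fun j : J => code @` sval j) idx_inj.
  move=> [F [clF nIF]] /=.
  have [h hF hinj] := perfect_image dM dC edense sB clF (codeF _ clF nIF).
  by exists (code \o h) => // t; exists (h t).
(* [S] splits the codes; a class is selected when its trace, the common code of its points, lies in
   [S]. By [hclosed] it suffices to meet positive closed sets. *)
exists [set E | A E /\ S (ball_trace d e E)] => [E []//|Q /hclosed].
move=> [F [clF nIF FQ]].
have [] := hS (exist _ F (conj clF nIF)).
move=> [c [Sc [x Fx xc]]] [c' [nSc [y Fy yc]]].
rewrite -{c}xc in Sc; rewrite -{c'}yc in nSc; split.
  exists x; split; last exact: FQ.
  have [E AE Ex] := class x; exists E => //=; split=> //.
  by rewrite -(codeE _ _ AE Ex).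
exists y; split; last exact: FQ.
by move=> [E [AE SE] Ey]; apply: nSc; rewrite (codeE _ _ AE Ey).
Qed.
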